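(* Let $(\tilde A_b,\tilde A_w)$ be a consistent fuzzy pairwise comparison system (FPCS). Then there are functions $K_1,K_2$ of $\alpha\in[0,1]$ (not depending on $i$) such that for all $i,i_1,i_2\in\{1,\dots,n\}\setminus\{b,w\}$ and all $\alpha\in[0,1]$: $$a_{bi}^l(\alpha)\, a_{iw}^u(\alpha)=K_1(\alpha),\qquad a_{bi}^u(\alpha)\, a_{iw}^l(\alpha)=K_2(\alpha),$$ $$a_{bi_1}^l(\alpha)\, a_{i_1w}^u(\alpha)\, a_{bi_2}^u(\alpha)\, a_{i_2w}^l(\alpha)=a_{bw}^l(\alpha)\, a_{bw}^u(\alpha),$$ $$a_{bi}^l(\alpha)\, a_{iw}^u(\alpha)\le a_{bw}^u(\alpha),\qquad a_{bi}^u(\alpha)\, a_{iw}^l(\alpha)\le a_{bw}^u(\alpha),\qquad a_{bi}^l(\alpha)\, a_{iw}^l(\alpha)\le a_{bw}^l(\alpha),$$ and, for every $i\in\{1,\dots,n\}\setminus\{b,w\}$, the functions of $\alpha\in[0,1]$ given by $$f(\alpha)=\frac{a_{bi}^l(\alpha)\, a_{iw}^u(\alpha)}{a_{bw}^u(\alpha)},\qquad g(\alpha)=\frac{a_{bi}^u(\alpha)\, a_{iw}^l(\alpha)}{a_{bw}^u(\alpha)},\qquad h(\alpha)=\frac{a_{bi}^l(\alpha)\, a_{iw}^l(\alpha)}{a_{bw}^l(\alpha)}$$ are increasing (i.e. $\alpha_1\le\alpha_2$ implies that the value at $\alpha_1$ is $\le$ the value at $\alpha_2$).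
   Context: A fuzzy number $\tilde A$ is given by a membership function $\mu:\mathbb R\to[0,1]$ that attains the value $1$, whose $\alpha$-cuts $\{x:\mu(x)\ge\alpha\}$ are closed intervals for all $\alpha\in(0,1]$, and whose support $\{x:\mu(x)>0\}$ is bounded. For $\alpha\in(0,1]$ the $\alpha$-cut is written $[A^l(\alpha),A^u(\alpha)]$, and $\alpha=0$ stands for the (closed) support, $[A^l(0),A^u(0)]$. Two fuzzy numbers are equal iff their supports and all their $\alpha$-cuts, $\alpha\in(0,1]$, are equal. A triangular fuzzy number (TFN) $(a,c,d)$, $a\le c\le d$, has $\alpha$-cuts $[a+\alpha(c-a),\,d-\alpha(d-c)]$. Arithmetic operations on fuzzy numbers are defined cut-wise: $(\tilde A*\tilde B)_\alpha=\{x*y:x\in\tilde A_\alpha,y\in\tilde B_\alpha\}$ for $\alpha\in(0,1]$, and likewise for the supports. The scale is $\tilde 1=(1,1,1)$, $\tilde k=(k-1,k,k+1)$ for $k=2,\dots,8$, $\tilde 9=(9,9,9)$. For $n$ criteria with a best criterion index $b$ and a worst criterion index $w\neq b$, an FPCS $(\tilde A_b,\tilde A_w)$ consists of $\tilde A_b=(\tilde a_{b1},\dots,\tilde a_{bn})$ and $\tilde A_w=(\tilde a_{1w},\dots,\tilde a_{nw})^T$, whose entries are TFNs from the scale, with $\tilde a_{bb}=\tilde a_{ww}=\tilde 1$ and common entry $\tilde a_{bw}$. The $\alpha$-cuts of the entries are written $[a_{ij}^l(\alpha),a_{ij}^u(\alpha)]$, $\alpha\in[0,1]$. The FPCS is consistent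 if there exist fuzzy numbers $\tilde w_1,\dots,\tilde w_n$ (not necessarily triangular; weights are nonnegative and, so that the quotients are defined, have no zero in the relevant denominators) such that $\frac{\tilde w_b}{\tilde w_i}=\tilde a_{bi}$, $\frac{\tilde w_i}{\tilde w_w}=\tilde a_{iw}$ and $\frac{\tilde w_b}{\tilde w_w}=\tilde a_{bw}$ for all $i\in\{1,\dots,n\}\setminus\{b,w\}$. *)

(* Defs.v *)
From HB Require Import structures.
From mathcomp Require Import all_boot all_order all_algebra.
From mathcomp Require Import all_classical all_reals all_analysis.
From mathcomp Require Import ring lra.

Set Implicit Arguments.
Unset Strict Implicit.
Unset Printing Implicit Defensive.

Import Order.TTheory GRing.Theory Num.Theory.
Import numFieldNormedType.Exports.

Local Open Scope classical_set_scope.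
Local Open Scope ring_scope.

Record fuzzyNumber (R : realType) := FuzzyNumber {
  memb :> R -> R;
  memb_itv : forall x, 0 <= memb x <= 1;
  memb_normal : exists x, memb x = 1;
  memb_cut : forall alpha, 0 < alpha <= 1 ->
    exists l u : R, [set x | alpha <= memb x] = `[l, u]%classic;
  memb_bounded : bounded_set [set x | 0 < memb x]
}.

(* The cut at level 0 is the closed support, which differs from the (trivial)
   superlevel set [set x | 0 <= A x]. Only alpha in [0, 1] is meaningful. *)
Definition cut (R : realType) (A : fuzzyNumber R) (alpha : R) : set R :=
  if 0 < alpha then [set x | alpha <= A x] else closure [set x | 0 < A x].

(* Cuts at levels in [0, 1] are nonempty compact intervals, so these are
   their left and right endpoints. *)
Definition cutl (R : realType) (A : fuzzyNumber R) (alpha : R) : R :=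
  inf (cut A alpha).

Definition cutu (R : realType) (A : fuzzyNumber R) (alpha : R) : R :=
  sup (cut A alpha).

(* Arithmetic on fuzzy numbers is cut-wise and two fuzzy numbers are equal iff
   all their cuts at levels in [0, 1] are, so this expresses A / B = C.
   Since division in R is total, it is only meaningful when 0 is not in the
   support of B. *)
Definition is_fquot (R : realType) (A B C : fuzzyNumber R) : Prop :=
  forall alpha, 0 <= alpha <= 1 ->
    [set x / y | x in cut A alpha & y in cut B alpha] = cut C alpha.

Definition tfn_memb (R : realType) (a c d x : R) : R :=
  if x == c then 1
  else if a <= x < c then (x - a) / (c - a)
  else if c < x <= d then (d - x) / (d - c)
  else 0.

Section TriangularFuzzyNumber.
Variables (R : realType) (a c d : R).
Hypothesis acd : a <= c <= d.

Lemma tfn_memb_itv x : 0 <= tfn_memb a c d x <= 1.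
Proof.
rewrite /tfn_memb; case: eqP => _; first by rewrite ler01 lexx.
case: ifP => [/andP[ax xc]|_].
  have h : 0 < c - a by lra.
  by rewrite divr_ge0 ?ler_pdivrMr //; lra.
case: ifP => [/andP[cx xd]|_]; last by rewrite lexx ler01.
have h : 0 < d - c by lra.
by rewrite divr_ge0 ?ler_pdivrMr //; lra.
Qed.

Lemma tfn_memb_normal : exists x, tfn_memb a c d x = 1.
Proof. by exists c; rewrite /tfn_memb eqxx. Qed.

Lemma tfn_memb_cut alpha : 0 < alpha <= 1 ->
  [set x | alpha <= tfn_memb a c d x] =
  `[a + alpha * (c - a), d - alpha * (d - c)]%classic.
Proof.
move=> /andP[al0 al1]; case/andP: acd => ac cd.
apply/seteqP; split=> x /=; rewrite in_itv /= /tfn_memb.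
- case: eqP => [-> _|_]; first by apply/andP; split; nra.
  case: ifP => [/andP[ax xc]|_].
    have h : 0 < c - a by lra.
    by rewrite ler_pdivlMr // => ?; apply/andP; split; nra.
  case: ifP => [/andP[cx xd]|_]; last by move=> ?; exfalso; lra.
  have h : 0 < d - c by lra.
  by rewrite ler_pdivlMr // => ?; apply/andP; split; nra.
- move=> /andP[lx xu]; case: eqP => [//|/eqP xc].
  have [xlt|xge] := ltP x c.
    have -> : a <= x by nra.
    have h : 0 < c - a by nra.
    by rewrite /= ler_pdivlMr //; lra.
  have cx : c < x by rewrite lt_neqAle eq_sym xc.
  rewrite andbF cx /=; have -> : x <= d by nra.
  have h : 0 < d - c by nra.
  by rewrite ler_pdivlMr //; lra.
Qed.

Lemma tfn_memb_support : [set x | 0 < tfn_memb a c d x] `<=` `[a, d]%classic.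
Proof.
move=> x /=; rewrite /tfn_memb in_itv /=; case/andP: acd => ac cd.
case: eqP => [-> _|_]; first by rewrite ac cd.
case: ifP => [/andP[ax xc] _|_]; first by rewrite ax; lra.
case: ifP => [/andP[cx xd] _|_]; first by rewrite xd andbT; lra.
by rewrite ltxx.
Qed.

Lemma tfn_memb_bounded : bounded_set [set x | 0 < tfn_memb a c d x].
Proof.
exists (`|a| + `|d|); split; first exact: num_real.
move=> M hM x /tfn_memb_support /=; rewrite in_itv /= => /andP[ax xd].
have := ler_norm d; have := ler_norm (- a); rewrite normrN => h1 h2.
have := normr_ge0 a; have := normr_ge0 d => h3 h4.
by rewrite ler_norml; apply/andP; split; lra.
Qed.

Definition tfn : fuzzyNumber R :=
  FuzzyNumber tfn_memb_itv tfn_memb_normal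
    (fun alpha h => ex_intro _ _ (ex_intro _ _ (tfn_memb_cut h)))
    tfn_memb_bounded.

Lemma closure_tfn_support :
  closure [set x | 0 < tfn_memb a c d x] = `[a, d]%classic.
Proof.
apply/seteqP; split.
  have /closure_id -> : closed `[a, d]%classic by exact: interval_closed.
  exact/closureS/tfn_memb_support.
move=> x /=; rewrite in_itv /= => /andP[ax xd]; case/andP: acd => ac cd.
move=> B /nbhs_ballP[e /= e0 xB].
have n0 : 0 < `|c - x| + e by have := normr_ge0 (c - x); lra.
pose t := e / (`|c - x| + e).
have t0 : 0 < t by rewrite divr_gt0.
have t1 : t <= 1 by rewrite ler_pdivrMr //; have := normr_ge0 (c - x); lra.
have te : t * `|c - x| < e.
  have E : t * `|c - x| + t * e = e.
    by rewrite -mulrDr /t divfK // gt_eqF.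
  by have := mulr_gt0 t0 e0; lra.
exists (x + t * (c - x)); split.
  rewrite /= /tfn_memb; case: eqP => [_|/eqP yc]; first exact: ltr01.
  have [xc|cx|xc] := ltgtP x c.
  - have -> : a <= x + t * (c - x) < c.
      apply/andP; split; first nra.
      by rewrite lt_neqAle yc; nra.
    by rewrite divr_gt0 //; nra.
  - have cy : c < x + t * (c - x) by rewrite lt_neqAle eq_sym yc; nra.
    rewrite cy [X in _ && X]lt_gtF // andbF /=.
    have -> : x + t * (c - x) <= d by nra.
    by rewrite divr_gt0 //; nra.
  - by move: yc; rewrite xc subrr mulr0 addr0 eqxx.
apply: xB; rewrite /ball /=.
by rewrite opprD addrA subrr add0r normrN normrM (gtr0_norm t0).
Qed.

Lemma cut_tfn alpha : 0 <= alpha <= 1 ->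
  cut tfn alpha = `[a + alpha * (c - a), d - alpha * (d - c)]%classic.
Proof.
move=> /andP[al0 al1]; rewrite /cut.
case: ltP => [al|al]; first by apply: tfn_memb_cut; rewrite al al1.
have -> : alpha = 0 by apply/le_anti; rewrite al al0.
by rewrite !mul0r addr0 subr0; exact: closure_tfn_support.
Qed.

Lemma cutl_tfn alpha : 0 <= alpha <= 1 ->
  cutl tfn alpha = a + alpha * (c - a).
Proof.
move=> h; rewrite /cutl cut_tfn // inf_itvcc //.
by case/andP: acd => ac cd; case/andP: h => al0 al1; nra.
Qed.

Lemma cutu_tfn alpha : 0 <= alpha <= 1 ->
  cutu tfn alpha = d - alpha * (d - c).
Proof.
move=> h; rewrite /cutu cut_tfn // sup_itvcc //.
by case/andP: acd => ac cd; case/andP: h => al0 al1; nra.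
Qed.

End TriangularFuzzyNumber.

(* The scale: (1, 1, 1), (k - 1, k, k + 1) for 2 <= k <= 8, and (9, 9, 9);
   other values of k are never used. *)
Definition scale_spread (k : nat) : nat :=
  if (k == 1%N) || (k == 9%N) then 0%N else 1%N.

Lemma scale_le (R : realType) (k : nat) :
  k%:R - (scale_spread k)%:R <= (k%:R : R) <= k%:R + (scale_spread k)%:R.
Proof. by rewrite lerBlDr lerDl ler0n. Qed.

Definition scale (R : realType) (k : nat) : fuzzyNumber R :=
  tfn (scale_le R k).

Record fpcs (R : realType) (n : nat) := Fpcs {
  best : 'I_n;
  worst : 'I_n;
  worst_neq_best : worst != best;
  best_cmp : 'I_n -> fuzzyNumber R;
  worst_cmp : 'I_n -> fuzzyNumber R;
  best_cmp_scale : forall i, exists2 k, (1 <= k <= 9)%N & best_cmp i = scale R k;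
  worst_cmp_scale :
    forall i, exists2 k, (1 <= k <= 9)%N & worst_cmp i = scale R k;
  best_cmp_best : best_cmp best = scale R 1;
  worst_cmp_worst : worst_cmp worst = scale R 1;
  best_cmp_worst : best_cmp worst = worst_cmp best
}.

(* [best_cmp S i] is a_{bi}, [worst_cmp S i] is a_{iw}. The denominators
   occurring in the system are all the weights but that of the best criterion. *)
Definition consistent (R : realType) (n : nat) (S : fpcs R n) : Prop :=
  exists w : 'I_n -> fuzzyNumber R,
    [/\ forall i x, cut (w i) 0 x -> 0 <= x,
        forall i, i != best S -> ~ cut (w i) 0 0,
        forall i, i != best S -> i != worst S ->
          is_fquot (w (best S)) (w i) (best_cmp S i) /\
          is_fquot (w i) (w (worst S)) (worst_cmp S i)
      & is_fquot (w (best S)) (w (worst S)) (best_cmp S (worst S))].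

Definition increasing01 (R : realType) (f : R -> R) : Prop :=
  forall alpha1 alpha2, 0 <= alpha1 -> alpha1 <= alpha2 -> alpha2 <= 1 ->
    f alpha1 <= f alpha2.

(* Main.v *)
Require Import Defs.
From mathcomp Require Import all_boot all_order all_algebra.
From mathcomp Require Import all_classical all_reals all_analysis.
From mathcomp Require Import ring lra.

Import Order.TTheory GRing.Theory Num.Theory.
Local Open Scope ring_scope.

(** Let p_i and q_i be the endpoints of the cut of the weight of criterion i at a
    fixed level. All weights are nonnegative, and positive in the denominators,
    so the cut of the quotient of the weights i and j has the endpoints
    p_i / q_j and q_i / p_j: consistency turns every endpoint of the comparison
    system into such a ratio. With b the best and w the worst criterion (t in
    the proof), the contribution of an inner criterion i then cancels,
      a_bi^l a_iw^u = (p_b / q_i) (q_i / p_w) = p_b / p_w,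
      a_bi^u a_iw^l = (q_b / p_i) (p_i / q_w) = q_b / q_w,
    which gives [K1] and [K2], and their product is
    (p_b / q_w) (q_b / p_w) = a_bw^l a_bw^u. The three functions turn out to be
      f = p_b / q_b,   g = p_w / q_w,   h = p_i / q_i,
    the ratio of the endpoints of a single weight; such a ratio is at most 1,
    whence the three inequalities, and it increases with the level because the
    cuts are nested.

    The formula for the cuts of a quotient ([cutlu_fquot]) rests on the fact
    that the endpoints of a cut belong to it. At a positive level this is part
    of the notion of a fuzzy number; at level 0, where the cut is the closure
    of a bounded set, it comes from compactness ([cutlP], [cutuP]). *)

Section Cuts.
Set Implicit Arguments.
Unset Strict Implicit.
Import numFieldNormedType.Exports.
Local Open Scope classical_set_scope.
(* The unqualified name is that of Dedekind cuts. *)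
Local Notation cut := Defs.cut.
Variable R : realType.
Implicit Types (A B C : fuzzyNumber R) (E : set R) (alpha x y : R).

Lemma inf_min E x : E x -> lbound E x -> inf E = x.
Proof.
move=> Ex lbx; apply/le_anti/andP; split; first by apply: ge_inf => //; exists x.
by apply: lb_le_inf => //; exists x.
Qed.

Lemma sup_max E x : E x -> ubound E x -> sup E = x.
Proof.
move=> Ex ubx; apply/le_anti/andP; split; first by apply: ge_sup => //; exists x.
by apply: ub_le_sup => //; exists x.
Qed.

(** Including level 0: a positive superlevel set lies in the support, hence in
    its closure. *)
Lemma subset_cut A alpha1 alpha2 : alpha1 <= alpha2 ->
  cut A alpha2 `<=` cut A alpha1.
Proof.
move=> le12; rewrite /cut; case: ltP => [a2|a2]; case: ltP => [a1|a1] x //=.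
- exact: le_trans.
- by move=> le2x; apply: subset_closure; exact: lt_le_trans le2x.
- by move: (lt_le_trans a1 le12); rewrite ltNge a2.
Qed.

Lemma cut_neq0 A alpha : alpha <= 1 -> cut A alpha !=set0.
Proof.
move=> a1; have [x Ax] := memb_normal A; exists x.
by apply: (subset_cut a1); rewrite /cut ltr01 /= Ax.
Qed.

Lemma compact_cut A alpha : 0 <= alpha <= 1 -> compact (cut A alpha).
Proof.
move=> /andP[a0 a1]; rewrite /cut; case: ltP => [a_gt0|_].
  have aP : 0 < alpha <= 1 by rewrite a_gt0.
  by have [l [u ->]] := memb_cut A aP; exact: segment_compact.
have [M [_ AM]] := memb_bounded A.
(* The bound of a bounded set holds only for the numbers above M, whence the
   + 1. *)
have cM : closed `[- (M + 1), M + 1] by exact: interval_closed.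
apply: (@subclosed_compact _ _ _ _ (@segment_compact R (- (M + 1)) (M + 1))).
  exact: closed_closure.
rewrite [X in _ `<=` X](closure_id _).1 //; apply: closureS => x Ax /=.
by rewrite in_itv /= -ler_norml; apply: AM => //; rewrite ltrDl ltr01.
Qed.

(** A continuous function, here the identity, attains its minimum on the
    compact cut. *)
Lemma cutlP A alpha : 0 <= alpha <= 1 ->
  cut A alpha (cutl A alpha) /\ lbound (cut A alpha) (cutl A alpha).
Proof.
move=> aP; have [_ a1] := andP aP.
have [|m /set_mem mA mlb] :=
  @compact_EVT_min _ _ id _ (cut_neq0 A a1) (@compact_cut A _ aP).
  by apply: continuous_subspaceT => x; exact: cvg_id.
have lbm : lbound (cut A alpha) m by move=> x Ax; apply: mlb; rewrite inE.
by rewrite /cutl (inf_min mA lbm).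
Qed.

Lemma cutuP A alpha : 0 <= alpha <= 1 ->
  cut A alpha (cutu A alpha) /\ ubound (cut A alpha) (cutu A alpha).
Proof.
move=> aP; have [_ a1] := andP aP.
have [|m /set_mem mA mub] :=
  @compact_EVT_max _ _ id _ (cut_neq0 A a1) (@compact_cut A _ aP).
  by apply: continuous_subspaceT => x; exact: cvg_id.
have ubm : ubound (cut A alpha) m by move=> x Ax; apply: mub; rewrite inE.
by rewrite /cutu (sup_max mA ubm).
Qed.

Lemma cutl_le_cutu A alpha : 0 <= alpha <= 1 -> cutl A alpha <= cutu A alpha.
Proof. by move=> aP; apply: (cutuP A aP).2; exact: (cutlP A aP).1. Qed.

(** Division is monotone in the numerator and antitone in the denominator, so
    the extrema of the quotient are reached at opposite endpoints. *)
Lemma cutlu_fquot A B C alpha : 0 <= alpha <= 1 -> is_fquot A B C ->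
  0 <= cutl A alpha -> 0 < cutl B alpha ->
  cutl C alpha = cutl A alpha / cutu B alpha /\
  cutu C alpha = cutu A alpha / cutl B alpha.
Proof.
move=> aP ABC Al0 Bl0; rewrite {1}/cutl {2}/cutu -(ABC _ aP).
have [lA lbA] := cutlP A aP; have [uA ubA] := cutuP A aP.
have [lB lbB] := cutlP B aP; have [uB ubB] := cutuP B aP.
have B_gt0 y : cut B alpha y -> 0 < y by move=> /lbB; exact: lt_le_trans.
have A_ge0 x : cut A alpha x -> 0 <= x by move=> /lbA; exact: le_trans.
split.
- apply: inf_min => [|_ [x Ax [y By <-]]].
    by exists (cutl A alpha) => //; exists (cutu B alpha).
  apply: ler_pM; [exact: Al0|by rewrite invr_ge0 ltW ?B_gt0|exact: lbA|].
  by rewrite lef_pV2 ?posrE ?B_gt0 //; exact: ubB.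
- apply: sup_max => [|_ [x Ax [y By <-]]].
    by exists (cutu A alpha) => //; exists (cutl B alpha).
  apply: ler_pM; [exact: A_ge0|by rewrite invr_ge0 ltW ?B_gt0|exact: ubA|].
  by rewrite lef_pV2 ?posrE ?B_gt0 //; exact: lbB.
Qed.

Lemma cut_ratio_le A alpha1 alpha2 :
  0 <= alpha1 -> alpha1 <= alpha2 -> alpha2 <= 1 ->
  0 <= cutl A alpha1 -> 0 < cutu A alpha2 ->
  cutl A alpha1 / cutu A alpha1 <= cutl A alpha2 / cutu A alpha2.
Proof.
move=> a1_ge0 le12 a2_le1 l1_ge0 u2_gt0.
have a1P : 0 <= alpha1 <= 1 by rewrite a1_ge0 (le_trans le12).
have a2P : 0 <= alpha2 <= 1 by rewrite (le_trans a1_ge0).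
have lel : cutl A alpha1 <= cutl A alpha2.
  exact/(cutlP A a1P).2/(subset_cut le12)/(cutlP A a2P).1.
have leu : cutu A alpha2 <= cutu A alpha1.
  exact/(cutuP A a1P).2/(subset_cut le12)/(cutuP A a2P).1.
have u1_gt0 : 0 < cutu A alpha1 by exact: lt_le_trans leu.
apply: ler_pM; [exact: l1_ge0|by rewrite invr_ge0 ltW|exact: lel|].
by rewrite lef_pV2.
Qed.

Lemma cutl_scale_gt0 k alpha : (1 <= k)%N -> 0 <= alpha <= 1 ->
  0 < cutl (scale R k) alpha.
Proof.
move=> k1 aP; rewrite cutl_tfn //.
have /andP[a0 a1] := aP.
case: k k1 => [|[|k]] //= _; rewrite /scale_spread /=; first lra.
(* The scale value is now k + 2, and its support starts at k + 1 or later. *)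
have k0 : 0 <= k%:R :> R by [].
rewrite -!natr1; case: (_ == _) => /=; nra.
Qed.

End Cuts.

Theorem theorem3 (R : realType) (n : nat) (S : fpcs R n) :
  consistent S ->
  let inner (i : 'I_n) := i != best S /\ i != worst S in
  let bl i := cutl (best_cmp S i) in
  let bu i := cutu (best_cmp S i) in
  let wl i := cutl (worst_cmp S i) in
  let wu i := cutu (worst_cmp S i) in
  let bwl := cutl (best_cmp S (worst S)) in
  let bwu := cutu (best_cmp S (worst S)) in
  exists K1 K2 : R -> R,
    (forall alpha : R, 0 <= alpha <= 1 ->
      (forall i, inner i ->
        bl i alpha * wu i alpha = K1 alpha /\
        bu i alpha * wl i alpha = K2 alpha) /\
      (forall i1 i2, inner i1 -> inner i2 ->
        bl i1 alpha * wu i1 alpha * bu i2 alpha * wl i2 alpha =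
        bwl alpha * bwu alpha) /\
      (forall i, inner i ->
        [/\ bl i alpha * wu i alpha <= bwu alpha,
            bu i alpha * wl i alpha <= bwu alpha &
            bl i alpha * wl i alpha <= bwl alpha])) /\
    (forall i, inner i ->
      [/\ increasing01 (fun alpha => bl i alpha * wu i alpha / bwu alpha),
          increasing01 (fun alpha => bu i alpha * wl i alpha / bwu alpha) &
          increasing01 (fun alpha => bl i alpha * wl i alpha / bwl alpha)]).
Proof.
move=> [w [w_ge0 w_neq0 w_inner w_bw]].
set b := best S in w_neq0 w_inner w_bw *.
set t := worst S in w_inner w_bw *.
move=> inner bl bu wl wu bwl bwu.
have tb : t != b := worst_neq_best S.
pose p i := cutl (w i); pose q i := cutu (w i).
have p_ge0 i x : 0 <= x <= 1 -> 0 <= p i x.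
  move=> xP; have [x0 _] := andP xP.
  exact/(w_ge0 i)/(subset_cut x0)/(cutlP (w i) xP).1.
have p_gt0 i x : i != b -> 0 <= x <= 1 -> 0 < p i x.
  move=> ib xP; have [x0 _] := andP xP.
  rewrite lt_neqAle p_ge0 // andbT; apply/eqP => px0; apply: (w_neq0 _ ib).
  by apply: (subset_cut x0); rewrite px0; exact: (cutlP (w i) xP).1.
have le_pq i x : 0 <= x <= 1 -> p i x <= q i x := @cutl_le_cutu _ (w i) x.
have q_gt0 i x : i != b -> 0 <= x <= 1 -> 0 < q i x.
  by move=> ib xP; exact: lt_le_trans (p_gt0 i x ib xP) (le_pq i x xP).
have eq_bw x : 0 <= x <= 1 -> bwl x = p b x / q t x /\ bwu x = q b x / p t x.
  by move=> xP; apply: cutlu_fquot; [| |exact: p_ge0|exact: p_gt0].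
have eq_b i x : inner i -> 0 <= x <= 1 ->
    bl i x = p b x / q i x /\ bu i x = q b x / p i x.
  move=> [ib it] xP; have [w_b _] := w_inner _ ib it.
  by apply: cutlu_fquot; [| |exact: p_ge0|exact: p_gt0].
have eq_w i x : inner i -> 0 <= x <= 1 ->
    wl i x = p i x / q t x /\ wu i x = q i x / p t x.
  move=> [ib it] xP; have [_ w_w] := w_inner _ ib it.
  by apply: cutlu_fquot; [| |exact: p_ge0|exact: p_gt0].
(* The weight of the best criterion is never a denominator in the system: that
   it is positive comes from the positivity of the scale instead. *)
have pb_gt0 x : 0 <= x <= 1 -> 0 < p b x.
  move=> xP; have [k /andP[k1 _] Ek] := best_cmp_scale S t.
  have : 0 < bwl x by rewrite /bwl Ek cutl_scale_gt0.
  by rewrite (eq_bw _ xP).1 pmulr_lgt0 // invr_gt0 q_gt0.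
have {p_ge0} p_gt0' i x : 0 <= x <= 1 -> 0 < p i x.
  by move=> xP; have [->|ib] := eqVneq i b; [exact: pb_gt0|exact: p_gt0].
have q_gt0' i x : 0 <= x <= 1 -> 0 < q i x.
  by move=> xP; exact: lt_le_trans (p_gt0' i x xP) (le_pq i x xP).
have q_neq0 i x : 0 <= x <= 1 -> q i x != 0 by move=> xP; rewrite gt_eqF ?q_gt0'.
have p_neq0 i x : 0 <= x <= 1 -> p i x != 0 by move=> xP; rewrite gt_eqF ?p_gt0'.
have bw_gt0 x : 0 <= x <= 1 -> 0 < bwl x /\ 0 < bwu x.
  by move=> xP; have [-> ->] := eq_bw _ xP; rewrite !divr_gt0 ?p_gt0' ?q_gt0'.
have K1E i x : inner i -> 0 <= x <= 1 -> bl i x * wu i x = p b x / p t x.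
  by move=> ii xP; rewrite (eq_b i x ii xP).1 (eq_w i x ii xP).2 mulrA divfK // q_neq0.
have K2E i x : inner i -> 0 <= x <= 1 -> bu i x * wl i x = q b x / q t x.
  by move=> ii xP; rewrite (eq_b i x ii xP).2 (eq_w i x ii xP).1 mulrA divfK // p_neq0.
have fE i x : inner i -> 0 <= x <= 1 ->
    bl i x * wu i x / bwu x = p b x / q b x.
  move=> ii xP; rewrite K1E // (eq_bw x xP).2.
  by field; rewrite ?p_neq0 ?q_neq0.
have gE i x : inner i -> 0 <= x <= 1 ->
    bu i x * wl i x / bwu x = p t x / q t x.
  move=> ii xP; rewrite K2E // (eq_bw x xP).2.
  by field; rewrite ?p_neq0 ?q_neq0.
have hE i x : inner i -> 0 <= x <= 1 ->
    bl i x * wl i x / bwl x = p i x / q i x.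
  move=> ii xP; rewrite (eq_b i x ii xP).1 (eq_w i x ii xP).1 (eq_bw x xP).1.
  by field; rewrite ?p_neq0 ?q_neq0.
have ratio_le1 i x : 0 <= x <= 1 -> p i x / q i x <= 1.
  by move=> xP; rewrite ler_pdivrMr ?q_gt0' // mul1r le_pq.
have ratio_incr F i :
    (forall x, 0 <= x <= 1 -> F x = p i x / q i x) -> increasing01 F.
  move=> FE x1 x2 x1_ge0 le12 x2_le1.
  have x1P : 0 <= x1 <= 1 by rewrite x1_ge0 (le_trans le12).
  have x2P : 0 <= x2 <= 1 by rewrite (le_trans x1_ge0).
  by rewrite !FE // cut_ratio_le // ?ltW ?p_gt0' ?q_gt0'.
exists (fun x => p b x / p t x), (fun x => q b x / q t x); split=> [x xP|i ii].
- have [bwl_gt0 bwu_gt0] := bw_gt0 x xP.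
  split; [|split] => [i ii|i1 i2 ii1 ii2|i ii].
  + by rewrite K1E ?K2E.
  + rewrite -mulrA K1E // K2E // (eq_bw x xP).1 (eq_bw x xP).2.
    by field; rewrite ?p_neq0 ?q_neq0.
  + split.
    * by rewrite -[leRHS]mul1r -ler_pdivrMr // fE // ratio_le1.
    * by rewrite -[leRHS]mul1r -ler_pdivrMr // gE // ratio_le1.
    * by rewrite -[leRHS]mul1r -ler_pdivrMr // hE // ratio_le1.
- split; [apply: (ratio_incr _ b)|apply: (ratio_incr _ t)|
          apply: (ratio_incr _ i)] => x; [exact: fE|exact: gE|exact: hE].
Qed.
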